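(* For every $\varepsilon>0$ and every integer $k\ge 2$, there exists a $C_{2k}$-free graph $G$ such that every subgraph of $G$ that is both bipartite and $C_4$-free has at most $\left(1-\frac{1}{2^{k-1}}\right)\frac{1}{k-1}\,e(G)\,(1+\varepsilon)$ edges.
   Context: $e(G)$ denotes the number of edges of a graph $G$. A graph is $C_{t}$-free if it contains no cycle of length $t$ as a subgraph. *)

(* Defs.v *)
From HB Require Import structures.
From mathcomp Require Import all_boot all_order all_algebra.
From mathcomp Require Import reals.
Set Implicit Arguments. Unset Strict Implicit. Unset Printing Implicit Defensive.

Definition simple_graph (T : finType) (E : rel T) : Prop :=
  symmetric E /\ irreflexive E.

Definition edges (T : finType) (E : rel T) : {set {set T}} :=
  [set [set x; y] | x in T, y in T & E x y].

Definition nedges (T : finType) (E : rel T) : nat := #|edges E|.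

(* G contains a cycle of length t as a subgraph: t distinct vertices
   v_0, ..., v_{t-1} with v_i ~ v_{i+1 mod t}. (Used for t >= 3.) *)
Definition has_cycle (T : finType) (E : rel T) (t : nat) : Prop :=
  exists f : 'I_t -> T, injective f /\ forall i : 'I_t, E (f i) (f (ordS i)).

Definition cycle_free (T : finType) (E : rel T) (t : nat) : Prop :=
  ~ has_cycle E t.

(* H (given by its adjacency relation F on the same vertex set) is a
   subgraph of G = (T, E). Isolated vertices are irrelevant here. *)
Definition subgraph (T : finType) (F E : rel T) : Prop :=
  symmetric F /\ (forall x y, F x y -> E x y).

Definition bipartite (T : finType) (F : rel T) : Prop :=
  exists c : T -> bool, forall x y, F x y -> c x != c y.

(* Main.v *)
(* Put a = k - 1 and take a sparse random-like (a + m)-uniform hypergraph with m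
   large, replacing each hyperedge by a copy of K_(a,m). If the hyperedges are
   pairwise far apart when they are added, every cycle of length 2k lies inside
   one copy, and K_(a,m) is too small on one side to contain C_(2k).

   Inside one copy, a C_4-free subgraph has at most one edge per vertex of the
   m-side, up to an additive a^2; and if the subgraph is properly 2-coloured by
   c, a vertex of the m-side that is monochromatic with the whole a-side has no
   edge at all. A random hyperedge makes such a vertex monochromatic with
   probability x^k + (1-x)^k >= 2^(1-k), so it suffices that every 2-colouring c
   of the vertices sees about this proportion on the chosen hyperedges.

   The hyperedges are chosen greedily, keeping the vertex degrees bounded so
   that only a small proportion d of the candidates is forbidden. The potential
   sum_c exp(- d * sum_e X_e(c)), with X_e(c) the monochromatic proportion of e,
   can be multiplied at each step by at most its average factor; there are
   only 2^N colourings, so linearly many steps in N make every term small,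
   that is, sum_e X_e(c) large for every c at once. *)
Require Import Defs.
From HB Require Import structures.
From mathcomp Require Import all_boot all_order all_algebra.
From mathcomp Require Import reals sequences exp.
From mathcomp Require Import zify ring lra.
Import Order.TTheory GRing.Theory Num.Theory.
Set Implicit Arguments. Unset Strict Implicit. Unset Printing Implicit Defensive.

(** * Greedy packing of tuples *)

Lemma leq_card_bigcup (J T : finType) (P : pred J) (F : J -> {set T}) :
  #|\bigcup_(j | P j) F j| <= \sum_(j | P j) #|F j|.
Proof.
elim/big_ind2: _ => [|A m B n leA leB|//]; first by rewrite cards0.
exact: leq_trans (leq_card_setU _ _) (leq_add leA leB).
Qed.

Lemma card_family_prod (I T : finType) (F : I -> pred T) :
  #|(family F : pred {ffun I -> T})| = \prod_i #|F i|.
Proof. by rewrite card_family foldrE big_map big_enum. Qed.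

Lemma card_ffun_coord (I T : finType) (i : I) (S : {set T}) :
  #|[set e : {ffun I -> T} | e i \in S]| * #|T| = #|S| * #|T| ^ #|I|.
Proof.
have -> : #|[set e : {ffun I -> T} | e i \in S]| =
    #|(family (fun l => [pred x | (l == i) ==> (x \in S)]) : pred {ffun I -> T})|.
  rewrite cardsE; apply: eq_card => e; rewrite !inE.
  apply/idP/forallP => [eiS l | /(_ i)]; last by rewrite ?inE /= eqxx.
  by rewrite ?inE /=; apply/implyP => /eqP ->.
rewrite card_family_prod (bigD1 i) //= -mulnA; congr (_ * _).
  by apply: eq_card => x; rewrite ?inE /= eqxx.
rewrite (eq_bigr (fun=> #|T|)) => [|l /negbTE li]; last first.
  by apply: eq_card => x; rewrite ?inE /= li.
rewrite prod_nat_const mulnC -expnS; congr (_ ^ _).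
rewrite [RHS](cardD1 i) inE add1n; congr _.+1.
by apply: eq_card => l; rewrite /= ?inE /= ?andbT.
Qed.

(** Fixing [e i = x] leaves at most [b] of the [#|T|] values for [e j], so a random tuple has this
    defect with probability at most [b / #|T|]; denominators are cleared. *)
Lemma card_ffun_pair (I T : finType) (i j : I) (B : T -> {set T}) (b : nat) :
  i != j -> (forall x, #|B x| <= b) ->
  #|[set e : {ffun I -> T} | e j \in B (e i)]| * #|T| <= b * #|T| ^ #|I|.
Proof.
move=> ij leB.
have -> : #|[set e : {ffun I -> T} | e j \in B (e i)]| =
  \sum_x #|[set e : {ffun I -> T} | (e i == x) && (e j \in B x)]|.
  rewrite -sum1dep_card (partition_big (fun e : {ffun I -> T} => e i) predT) //=.
  apply: eq_bigr => x _; rewrite -sum1dep_card; apply: eq_bigl => e.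
  by rewrite andbC; case: eqP => // ->.
have cardI : #|I| = (#|[pred l | (l != i) && (l != j)]|).+2.
  rewrite (cardD1 i) (cardD1 j) !inE eq_sym ij /= !add1n; congr _.+2.
  by apply: eq_card => l; rewrite ?inE /= ?andbT andbC.
have cnt x : #|[set e : {ffun I -> T} | (e i == x) && (e j \in B x)]| =
    #|B x| * #|T| ^ (#|[pred l | (l != i) && (l != j)]|).
  transitivity #|(family (fun l =>
      [pred y | ((l == i) ==> (y == x)) && ((l == j) ==> (y \in B x))])
        : pred {ffun I -> T})|.
    rewrite cardsE; apply: eq_card => e; rewrite !inE.
    apply/andP/forallP => [[eix ejB] l | H]; last first.
      by have := H i; have := H j; rewrite ?inE /= !eqxx /= => /andP[_ ->] /andP[-> _].
    by rewrite ?inE /=; apply/andP; split; apply/implyP => /eqP ->.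
  rewrite card_family_prod (bigD1 i) //= (bigD1 j) /= 1?eq_sym //.
  rewrite -[RHS]mul1n; congr (_ * (_ * _)).
    rewrite -(card1 x); apply: eq_card => y.
    by rewrite unfold_in /= eqxx [j == i]eq_sym (negbTE ij) andbT inE.
    by apply: eq_card => y; rewrite unfold_in /= eqxx [j == i]eq_sym (negbTE ij).
  rewrite (eq_bigr (fun=> #|T|)) => [|l /andP[/negbTE li /negbTE lj]]; last first.
    by apply: eq_card => y; rewrite ?inE /= li lj.
  by rewrite prod_nat_const.
under eq_bigr do rewrite cnt.
rewrite -big_distrl /= cardI !expnS.
have : \sum_x #|B x| <= #|T| * b by rewrite -sum_nat_const leq_sum.
move=> H; rewrite -mulnA; apply: leq_trans (leq_mul H (leqnn _)) _.
by apply: eq_leq; ring.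
Qed.

Definition hits {I T : finType} (e : {ffun I -> T}) (x : T) : bool :=
  [exists l, e l == x].

Definition vdeg {I T : finType} (es : seq {ffun I -> T}) (x : T) : nat :=
  count (fun e => hits e x) es.

Definition cohit {I T : finType} (es : seq {ffun I -> T}) : rel T :=
  fun x y => has (fun e => hits e x && hits e y) es.

(** One step joins any two vertices of a common tuple, so paths in the union of bicliques are also
    paths for this metric. *)
Fixpoint ball {I T : finType} (es : seq {ffun I -> T}) (l : nat) (x : T) : {set T} :=
  if l is l'.+1
  then ball es l' x :|: \bigcup_(y in ball es l' x) [set z | cohit es y z]
  else [set x].

(* The degree cap [D] keeps the balls small; it is what makes almost all
   tuples [spread] at every step. *)
Definition spread {I T : finType} (D L : nat) (es : seq {ffun I -> T})
    (e : {ffun I -> T}) : bool :=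
  [forall i, (vdeg es (e i) < D) &&
    [forall j, (i != j) ==> (e j \notin ball es L (e i))]].

(** The head is the newest tuple; each tuple is tested only against the older ones behind it. *)
Fixpoint packed {I T : finType} (D L : nat) (es : seq {ffun I -> T}) : bool :=
  if es is e :: es' then spread D L es' e && packed D L es' else true.

Lemma card_hits (I T : finType) (e : {ffun I -> T}) : #|[set z | hits e z]| <= #|I|.
Proof.
apply: (@leq_trans #|[set e l | l in I]|); last exact: leq_imset_card.
apply/subset_leq_card/subsetP => z.
by rewrite inE => /existsP[l /eqP <-]; apply: imset_f.
Qed.

Lemma card_cohit (I T : finType) (es : seq {ffun I -> T}) (y : T) :
  #|[set z | cohit es y z]| <= #|I| * vdeg es y.
Proof.
elim: es => [|e es IH]; first by rewrite muln0 leqn0 cards_eq0; apply/eqP/setP => z; rewrite !inE.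
have -> : [set z | cohit (e :: es) y z] =
   [set z | hits e y && hits e z] :|: [set z | cohit es y z].
  by apply/setP => z; rewrite !inE.
apply: leq_trans (leq_card_setU _ _) _; rewrite /vdeg /= mulnDr leq_add //.
case: (hits e y); first by rewrite muln1 card_hits.
by rewrite muln0 leqn0 cards_eq0; apply/eqP/setP => z; rewrite !inE.
Qed.

Lemma card_ball (I T : finType) (es : seq {ffun I -> T}) (D l : nat) (x : T) :
  (forall y, vdeg es y <= D) -> #|ball es l x| <= (1 + #|I| * D) ^ l.
Proof.
move=> degD; elim: l => [|l IH] /=; first by rewrite cards1.
apply: leq_trans (leq_card_setU _ _) _.
have H : #|\bigcup_(y in ball es l x) [set z | cohit es y z]| <= #|ball es l x| * (#|I| * D).
  rewrite -sum_nat_const.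
  apply: leq_trans (leq_card_bigcup _ _) _.
  by apply: leq_sum => y _; apply: leq_trans (card_cohit _ _) _; rewrite leq_mul2l degD orbT.
apply: leq_trans (leq_add (leqnn _) H) _.
by rewrite -mulnS expnSr add1n leq_mul2r IH orbT.
Qed.

Lemma packed_vdeg (I T : finType) (D L : nat) (es : seq {ffun I -> T}) (x : T) :
  packed D L es -> vdeg es x <= D.
Proof.
elim: es => [|e es IH] //= /andP[/forallP sp pk]; rewrite /vdeg /=.
case: (boolP (hits e x)) => [/existsP[i /eqP ei]|_]; last exact: IH.
by have /andP[+ _] := sp i; rewrite ei.
Qed.

Lemma sum_vdeg (I T : finType) (es : seq {ffun I -> T}) :
  \sum_x vdeg es x <= #|I| * size es.
Proof.
elim: es => [|e es IH]; first by rewrite big1.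
rewrite /vdeg /= big_split /= mulnS leq_add //.
rewrite -big_mkcond /= sum1dep_card; exact: card_hits.
Qed.

Lemma card_saturated (I T : finType) (es : seq {ffun I -> T}) (D : nat) :
  #|[set x | D <= vdeg es x]| * D <= #|I| * size es.
Proof.
apply: leq_trans (sum_vdeg _); rewrite -sum_nat_const big_mkcond /=.
by apply: leq_sum => x _; rewrite inE; case: ifP.
Qed.

(** Union bound: a bad tuple meets a saturated vertex or has one coordinate in the ball around
    another, and the cap [D] on all degrees bounds the balls. *)
Lemma card_not_spread (I T : finType) (D L : nat) (es : seq {ffun I -> T}) :
  packed D L es ->
  #|[set e : {ffun I -> T} | ~~ spread D L es e]| * #|T| <=
  (#|I| * #|[set x | D <= vdeg es x]| + #|I| ^ 2 * (1 + #|I| * D) ^ L) * #|T| ^ #|I|.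
Proof.
move=> pk; set S := [set x | _]; set b := (_ ^ L).
have sub : [set e : {ffun I -> T} | ~~ spread D L es e] \subset
    (\bigcup_i [set e : {ffun I -> T} | e i \in S]) :|:
    (\bigcup_(p : I * I | p.1 != p.2) [set e : {ffun I -> T} | e p.2 \in ball es L (e p.1)]).
  apply/subsetP => e; rewrite inE => /forallPn[i]; rewrite negb_and -leqNgt => /orP[deg|].
    by apply/setUP; left; apply/bigcupP; exists i => //; rewrite !inE.
  case/forallPn=> j; rewrite negb_imply negbK => /andP[ij near].
  by apply/setUP; right; apply/bigcupP; exists (i, j); rewrite //= inE.
have card_bigU (J : finType) (P : pred J) (F : J -> {set {ffun I -> T}}) c :
    (forall j, P j -> #|F j| * #|T| <= c) ->
    #|\bigcup_(j | P j) F j| * #|T| <= #|J| * c.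
  move=> H; apply: (@leq_trans (\sum_(j | P j) c)); last first.
    by rewrite sum_nat_const leq_mul2r max_card orbT.
  apply: (@leq_trans ((\sum_(j | P j) #|F j|) * #|T|)); last first.
    by rewrite big_distrl; apply: leq_sum.
  by rewrite leq_mul2r leq_card_bigcup orbT.
apply: leq_trans (leq_mul (subset_leq_card sub) (leqnn _)) _.
apply: leq_trans (leq_mul (leq_card_setU _ _) (leqnn _)) _.
rewrite !mulnDl -!mulnA leq_add //.
  by apply: card_bigU => i _; rewrite card_ffun_coord.
rewrite mulnA -card_prod; apply: card_bigU => p ij.
by apply: card_ffun_pair => // x; apply: card_ball => y; apply: packed_vdeg pk.
Qed.

(** * Unions of bicliques *)

Definition joins {a m : nat} {T : finType} (e : {ffun 'I_a + 'I_m -> T}) (x y : T) : bool :=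
  [exists i : 'I_a, [exists j : 'I_m, (x == e (inl i)) && (y == e (inr j))]].

Definition union_graph {a m : nat} {T : finType}
    (es : seq {ffun 'I_a + 'I_m -> T}) : rel T :=
  fun x y => has (fun e => joins e x y || joins e y x) es.

Lemma joins_hits (a m : nat) (T : finType) (e : {ffun 'I_a + 'I_m -> T}) (x y : T) :
  joins e x y || joins e y x -> hits e x && hits e y.
Proof.
by case/orP=> /existsP[i /existsP[j /andP[/eqP -> /eqP ->]]]; apply/andP; split;
  apply/existsP; eexists; apply: eqxx.
Qed.

Lemma union_graph_cohit (a m : nat) (T : finType) (es : seq {ffun 'I_a + 'I_m -> T})
    (x y : T) : union_graph es x y -> cohit es x y.
Proof. by apply: sub_has => e; apply: joins_hits. Qed.

(** * Short cycles in the union of bicliques *)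

Lemma ball_step (I T : finType) (es : seq {ffun I -> T}) (l : nat) (x y z : T) :
  y \in ball es l x -> cohit es y z -> z \in ball es l.+1 x.
Proof. by move=> yB yz; apply/setUP; right; apply/bigcupP; exists y; rewrite ?inE. Qed.

Lemma ball_mono (I T : finType) (es : seq {ffun I -> T}) (l l' : nat) (x : T) :
  l <= l' -> ball es l x \subset ball es l' x.
Proof.
move/subnK <-; elim: (l' - l) => [|d IH] //=.
exact: subset_trans IH (subsetUl _ _).
Qed.

Lemma spread_far (I T : finType) (D L l : nat) (es : seq {ffun I -> T})
    (e : {ffun I -> T}) (x y : T) :
  spread D L es e -> l <= L -> hits e x -> hits e y -> y \in ball es l x -> x = y.
Proof.
move=> /forallP sp lL /existsP[i /eqP <-] /existsP[j /eqP <-] near.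
have /andP[_ /forallP/(_ j)] := sp i.
case: eqVneq => [-> //|_] /=.
by rewrite (subsetP (ball_mono es _ lL) _ near).
Qed.

(** Equal values at two distinct coordinates would be at distance 0. *)
Lemma spread_inj (I T : finType) (D L : nat) (es : seq {ffun I -> T}) (e : {ffun I -> T}) :
  spread D L es e -> injective e.
Proof.
move=> /forallP sp i j eij; have /andP[_ /forallP/(_ j)] := sp i.
case: eqVneq => // _ /=; rewrite -eij (subsetP (ball_mono es _ (leq0n L))) //=.
by rewrite inE.
Qed.

Lemma val_iter_ordS (n l : nat) (i : 'I_n) : val (iter l (@ordS n) i) = (i + l) %% n.
Proof.
elim: l => [|l IH] /=; first by rewrite addn0 modn_small.
by rewrite IH -addn1 modnDml addn1 addnS.
Qed.

Lemma iter_ordS_eq (n l : nat) (i : 'I_n) : l < n -> iter l (@ordS n) i = i -> l = 0.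
Proof.
move=> ln /(congr1 val); rewrite val_iter_ordS => H.
have /eqP : i + l = i + 0 %[mod n] by rewrite addn0 H modn_small.
by rewrite eqn_modDl mod0n modn_small // => /eqP.
Qed.

Lemma iter_ordS_reach (n : nat) (i j : 'I_n) : exists2 l, l < n & iter l (@ordS n) i = j.
Proof.
have n0 : 0 < n := leq_ltn_trans (leq0n i) (ltn_ord i).
exists ((j + (n - i)) %% n); first by rewrite ltn_mod.
apply: val_inj; rewrite val_iter_ordS modnDmr addnC -addnA subnK ?(ltnW (ltn_ord i)) //.
by rewrite modnDr modn_small.
Qed.

(* A maximal run of old edges on a cycle joins two vertices of [e] that are
   close in the old graph, so it is empty or the whole cycle. *)
Lemma cycle_old_or_new (a m : nat) (T : finType) (D L n : nat)
    (es : seq {ffun 'I_a + 'I_m -> T}) (e : {ffun 'I_a + 'I_m -> T}) (f : 'I_n -> T) :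
  n <= L -> spread D L es e -> injective f ->
  (forall i, union_graph (e :: es) (f i) (f (ordS i))) ->
  (forall i, union_graph es (f i) (f (ordS i))) \/
  (forall i, joins e (f i) (f (ordS i)) || joins e (f (ordS i)) (f i)).
Proof.
move=> nL sp injf cyc.
set new := fun i => joins e (f i) (f (ordS i)) || joins e (f (ordS i)) (f i).
case: (boolP [exists i, new i]) => [/existsP[i0 new0]|/existsPn old]; last first.
  by left=> i; have := cyc i; rewrite /union_graph /= -/(new i) (negbTE (old i)).
right=> i1; rewrite -/(new i1); apply/negPn/negP => old1.
(* Walking from a new edge towards the old edge at [i1], some new edge is directly followed by an
   old one. *)
have step l i : new i -> iter l (@ordS n) i = i1 -> exists2 i', new i' & ~~ new (ordS i').
  elim: l i => [|l IH] i newi /=; first by move=> ii1; rewrite -ii1 newi in old1.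
  case: (boolP (new (ordS i))) => [newSi|]; last by exists i.
  by rewrite -iterS iterSr; apply: IH.
have [l _ i01] := iter_ordS_reach i0 i1.
have {l i01} [i newi oldSi] := step _ _ new0 i01.
(* The walk from [ordS i] returns to the new edge at [i] in fewer than [n] steps, so the first new
   edge met, after [q] old ones, has [q < n]. *)
have [r rn ri] := iter_ordS_reach (ordS i) i.
have exq : exists q, new (iter q (@ordS n) (ordS i)) by exists r; rewrite ri.
have := ex_minnP exq; case=> q newq minq.
have qn : q < n by apply: leq_ltn_trans (minq r _) rn; rewrite ri.
have near s : s <= q -> f (iter s (@ordS n) (ordS i)) \in ball es s (f (ordS i)).
  elim: s => [|s IH] sq; first by rewrite inE.
  apply: ball_step (IH (ltnW sq)) _; apply: union_graph_cohit.
  have := cyc (iter s (@ordS n) (ordS i)); rewrite /union_graph /= -/(new _).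
  case/orP => // news; have := minq _ news; by rewrite leqNgt sq.
have /andP[_ hit1] := joins_hits newi.
have /andP[hit2 _] := joins_hits newq.
(* The [q] old edges join two vertices of [e], which therefore coincide; on a cycle this forces
   [q = 0], yet the edge at [ordS i] is not new. *)
have := spread_far sp (leq_trans (ltnW qn) nL) hit1 hit2 (near q (leqnn q)).
move/injf/esym/(iter_ordS_eq qn) => q0.
by rewrite q0 /= (negbTE oldSi) in newq.
Qed.

(** The cycle alternates between the sides, so [a.+1] of its vertices would lie in the side of size
    [a]. *)
Lemma no_long_cycle_in_biclique (a m : nat) (T : finType)
    (e : {ffun 'I_a + 'I_m -> T}) (f : 'I_(2 * a.+1) -> T) :
  injective e -> injective f ->
  ~ (forall i, joins e (f i) (f (ordS i)) || joins e (f (ordS i)) (f i)).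
Proof.
move=> inje injf alle.
pose A := [set e (inl i) | i in 'I_a].
have alt i : (f (ordS i) \in A) = (f i \notin A).
  have inA i' : e (inl i') \in A by apply: imset_f.
  have inB j' : e (inr j') \in A = false.
    by apply/negP => /imsetP[i' _ /inje].
  by case/orP: (alle i) => /existsP[i' /existsP[j' /andP[/eqP -> /eqP ->]]]; rewrite inA inB.
pose P := [set i | f i \in A].
have cardP : #|P| <= a.
  rewrite -(card_imset _ injf) -[a in _ <= a]card_ord.
  apply: (@leq_trans #|A|); last exact: leq_imset_card.
  by apply/subset_leq_card/subsetP => x /imsetP[i]; rewrite inE => fi ->.
have cardPC : #|~: P| = #|P|.
  rewrite -(card_imset _ (bij_inj (ordS_bij _))); apply: eq_card => i.
  apply/imsetP/idP => [[i' i'P ->]|iP].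
    by move: i'P; rewrite !inE alt.
  exists (ord_pred i); last by rewrite ord_predK.
  by move: iP; rewrite !inE -{1}[i]ord_predK alt.
have := cardsC P; rewrite cardPC card_ord; lia.
Qed.

Lemma packed_cycle_free (a m : nat) (T : finType) (D L : nat)
    (es : seq {ffun 'I_a + 'I_m -> T}) :
  2 * a.+1 <= L -> packed D L es -> cycle_free (union_graph es) (2 * a.+1).
Proof.
move=> nL; elim: es => [_ [f [_ /(_ (Ordinal (isT : 0 < 2 * a.+1)))]] //|e es IH].
move=> /andP[sp pk] [f [injf cyc]].
case: (cycle_old_or_new nL sp injf cyc) => [old|]; first by apply: (IH pk); exists f.
exact: no_long_cycle_in_biclique (spread_inj sp) injf.
Qed.

Lemma union_graph_simple (a m : nat) (T : finType) (D L : nat)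
    (es : seq {ffun 'I_a + 'I_m -> T}) :
  packed D L es -> simple_graph (union_graph es).
Proof.
move=> pk; split=> [x y|x]; first by apply: eq_has => e; rewrite orbC.
elim: es pk => //= e es IH /andP[sp pk].
rewrite /union_graph /= -/(union_graph es x x) (IH pk) orbF orbb.
by apply/existsP => -[i /existsP[j /andP[/eqP -> /eqP /(spread_inj sp)]]].
Qed.

(** * Edge counts of the union and its subgraphs *)

Definition bipairs {a m : nat} {T : finType} (e : {ffun 'I_a + 'I_m -> T}) (F : rel T) :
  nat := \sum_(j < m) #|[set i : 'I_a | F (e (inl i)) (e (inr j))]|.

Lemma edgesP (T : finType) (F : rel T) (s : {set T}) :
  reflect (exists x y, F x y /\ s = [set x; y]) (s \in edges F).
Proof.
apply: (iffP imset2P) => [[x y _]|[x [y [Fxy ->]]]].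
  by rewrite !inE => /= Fxy ->; exists x, y.
by exists x y; rewrite ?inE.
Qed.

Lemma nedges_le_bipairs (a m : nat) (T : finType) (es : seq {ffun 'I_a + 'I_m -> T})
    (F : rel T) :
  subgraph F (union_graph es) -> nedges F <= \sum_(e <- es) bipairs e F.
Proof.
move=> [symF subF].
pose K (e : {ffun 'I_a + 'I_m -> T}) := \bigcup_(j : 'I_m)
  [set [set e (inl i); e (inr j)] | i in [set i : 'I_a | F (e (inl i)) (e (inr j))]].
have sub : edges F \subset \bigcup_(e <- es) K e.
  apply/subsetP => s /edgesP[x [y [Fxy ->]]].
  have [e ees] := hasP (subF _ _ Fxy).
  have inK u v : F u v -> joins e u v -> [set u; v] \in \bigcup_(e <- es) K e.
    move=> Fuv /existsP[i /existsP[j /andP[/eqP ui /eqP vj]]].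
    rewrite bigcup_seq; apply/bigcupP; exists e => //; apply/bigcupP; exists j => //.
    by apply/imsetP; exists i; rewrite ?inE -?ui -?vj.
  by case/orP; [exact: inK|rewrite setUC; apply: inK; rewrite symF].
apply: leq_trans (subset_leq_card sub) _.
elim: es {subF sub} => [|e es IH]; first by rewrite !big_nil cards0.
rewrite !big_cons; apply: leq_trans (leq_card_setU _ _) (leq_add _ IH).
apply: leq_trans (leq_card_bigcup _ _) _.
by apply: leq_sum => j _; apply: leq_imset_card.
Qed.

(** The bicliques share no edge: an old edge between two vertices of the new tuple would put them at
    distance at most 1, forcing them to be equal and the edge to be a loop. *)
Lemma nedges_packed (a m : nat) (T : finType) (D L : nat)
    (es : seq {ffun 'I_a + 'I_m -> T}) :
  0 < L -> packed D L es -> size es * (a * m) <= nedges (union_graph es).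
Proof.
move=> L0; elim: es => [|e es IH] //= /andP[sp pk]; have inje := spread_inj sp.
rewrite mulSn addnC; set g := fun p : 'I_a * 'I_m => [set e (inl p.1); e (inr p.2)].
have injg : injective g.
  move=> [i j] [i' j'] /setP eqg; congr (_, _).
    have := eqg (e (inl i)); rewrite !inE eqxx /= => /esym /orP[] /eqP /inje //.
    by case.
  have := eqg (e (inr j)); rewrite !inE eqxx orbT /= => /esym /orP[] /eqP /inje //.
  by case.
have cardg : #|[set g p | p in {: 'I_a * 'I_m}]| = a * m.
  by rewrite card_imset // card_prod !card_ord.
have dis : [disjoint edges (union_graph es) & [set g p | p in {: 'I_a * 'I_m}]].
  apply/pred0P => s /=; apply/negP => /andP[/edgesP[x [y [xy ->]]] /imsetP[[i j] _ eqs]].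
  have hx : hits e x.
    have : x \in g (i, j) by rewrite -eqs !inE eqxx.
    by rewrite !inE => /orP[] /eqP ->; apply/existsP; eexists; apply: eqxx.
  have hy : hits e y.
    have : y \in g (i, j) by rewrite -eqs !inE eqxx orbT.
    by rewrite !inE => /orP[] /eqP ->; apply/existsP; eexists; apply: eqxx.
  have yB : y \in ball es 1 x.
    by apply: ball_step (union_graph_cohit xy); rewrite inE.
  have [_ /(_ x)] := union_graph_simple pk.
  by rewrite {2}(spread_far sp L0 hx hy yB) xy.
apply: leq_trans (leq_add (IH pk) (leqnn _)) _.
rewrite -cardg.
have /leqifP := leq_card_setU (edges (union_graph es)) [set g p | p in {: 'I_a * 'I_m}].
rewrite dis => /eqP <-; apply/subset_leq_card/subsetP => s.
case/setUP=> [/edgesP[x [y [xy ->]]]|/imsetP[[i j] _ ->]].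
  by apply/edgesP; exists x, y; rewrite /union_graph /= -/(union_graph es x y) xy orbT.
apply/edgesP; exists (e (inl i)), (e (inr j)); split=> //; rewrite /union_graph /=.
by apply/orP; left; apply/orP; left; apply/existsP; exists i; apply/existsP; exists j;
  rewrite !eqxx.
Qed.

(** * Monochromatic vertices *)

(** The right side minus the left is [(x ^ n - y ^ n) * (x - y)], whose factors never have opposite
    signs. *)
Lemma expn_rearrangement (x y n : nat) : x ^ n * y + y ^ n * x <= x ^ n.+1 + y ^ n.+1.
Proof.
wlog le_xy : x y / x <= y => [W|].
  by case/orP: (leq_total x y) => /W //; rewrite [X in X <= _]addnC [X in _ <= X]addnC.
have: x ^ n <= y ^ n by case: n => // n; rewrite leq_exp2r.
rewrite !expnS; move: (x ^ n) (y ^ n) => u v; nia.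
Qed.

(** Convexity of the power. With [x], [y] the colour class sizes and [n = a], it bounds from below
    by 2^-a the probability that [a.+1] random vertices share a colour. *)
Lemma expn_mean (x y n : nat) : (x + y) ^ n.+1 <= 2 ^ n * (x ^ n.+1 + y ^ n.+1).
Proof.
elim: n => [|n IH]; first by rewrite expn0 !expn1 mul1n.
rewrite expnS; apply: leq_trans (leq_mul (leqnn _) IH) _.
have := expn_rearrangement x y n.+1.
rewrite (expnS 2) (expnS x n.+1) (expnS y n.+1); move: (x ^ n.+1) (y ^ n.+1) (2 ^ n) => u v w; nia.
Qed.

Definition mono {a m : nat} {T : finType} (e : {ffun 'I_a + 'I_m -> T}) (c : T -> bool) :
  {set 'I_m} := [set j | [forall i : 'I_a, c (e (inl i)) == c (e (inr j))]].

Lemma no_two_common_neighbours (T : finType) (F : rel T) (x x' y y' : T) :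
  symmetric F -> cycle_free F 4 -> uniq [:: x; y; x'; y'] ->
  F x y -> F x' y -> F x y' -> F x' y' -> False.
Proof.
move=> symF noC4 us xy x'y xy' x'y'; apply: noC4.
exists (fun i : 'I_4 => nth x [:: x; y; x'; y'] i); split=> [i j /eqP|].
  by rewrite nth_uniq ?ltn_ord // => /eqP /val_inj.
by case=> [[|[|[|[|//]]]] ?] /=; rewrite // symF.
Qed.

(** A vertex of the m-side with r >= 1 neighbours in the copy is not monochromatic, and r - 1 is at
    most its number of ordered pairs of distinct neighbours. By C_4-freeness each pair belongs to at
    most one such vertex, so the pairs total at most [a ^ 2]. *)
Lemma bipairs_mono_bound (a m : nat) (T : finType) (e : {ffun 'I_a + 'I_m -> T})
    (F : rel T) (c : T -> bool) :
  injective e -> symmetric F -> cycle_free F 4 -> (forall x y, F x y -> c x != c y) ->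
  bipairs e F + #|mono e c| <= m + a ^ 2.
Proof.
move=> inje symF noC4 propc.
pose N (j : 'I_m) := [set i : 'I_a | F (e (inl i)) (e (inr j))].
pose P (j : 'I_m) := [set p : 'I_a * 'I_a | [&& p.1 != p.2, p.1 \in N j & p.2 \in N j]].
have cardN j : #|N j| + (j \in mono e c) <= 1 + #|P j|.
  case: (set_0Vmem (N j)) => [->|[i0 i0N]].
    by rewrite cards0 add0n; case: (_ \in _).
  have -> : (j \in mono e c) = false.
    rewrite inE; apply/negbTE/forallPn; exists i0.
    by apply: propc; move: i0N; rewrite inE.
  (* Pairing the fixed neighbour [i0] with every other one gives enough elements of [P j]. *)
  rewrite addn0 (cardsD1 i0) i0N leq_add2l.
  rewrite -(@card_imset _ _ (fun i => (i0, i))) => [|i i' [] //].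
  apply/subset_leq_card/subsetP => p /imsetP[i]; rewrite !inE => /andP[ii0 Fi] ->.
  by move: i0N; rewrite inE eq_sym ii0 => -> /=.
have sumP : \sum_j #|P j| <= a ^ 2.
  have -> : \sum_j #|P j| = \sum_(p : 'I_a * 'I_a) #|[set j | p \in P j]|.
    rewrite (eq_bigr (fun j => \sum_(p | p \in P j) 1)) => [|j _]; last by rewrite sum1_card.
    rewrite (exchange_big_dep predT) //=; apply: eq_bigr => p _.
    by rewrite -sum1dep_card.
  have -> : a ^ 2 = \sum_(p : 'I_a * 'I_a) 1 by rewrite sum1_card card_prod card_ord mulnn.
  apply: leq_sum => -[i i'] _; apply/card_le1P => j; rewrite inE => jP j'; rewrite !inE /=.
  move: jP; rewrite !inE /= => /and3P[ii' ij i'j].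
  apply/and3P/eqP => [[_ ij' i'j']|->//].
  apply/eqP/negPn/negP => jj'.
  apply: (no_two_common_neighbours symF noC4 _ ij i'j ij' i'j') => /=.
  rewrite !inE !(inj_eq inje) /= !andbT.
  apply/andP; split; apply/negP; first by case/orP=> /eqP // [] /eqP; apply/negP.
  by move=> /eqP[] /eqP; rewrite eq_sym; apply/negP.
have -> : #|mono e c| = \sum_j (j \in mono e c) by rewrite -sum1_card big_mkcond.
rewrite /bipairs -big_split /=; apply: (@leq_trans (\sum_j (1 + #|P j|))).
  by apply: leq_sum => j _; apply: cardN.
by rewrite big_split /= sum1_card card_ord leq_add2l.
Qed.

(** Split by the common colour: [a.+1] coordinates are confined to one colour class and the other
    [m.-1] are free; then apply [expn_mean]. *)
Lemma card_mono_coord (a m : nat) (T : finType) (c : T -> bool) (j : 'I_m) :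
  #|T| ^ (a + m) <= 2 ^ a * #|[set e : {ffun 'I_a + 'I_m -> T} | j \in mono e c]|.
Proof.
pose n b := #|[pred x | c x == b]|.
have cnt b : #|[set e : {ffun 'I_a + 'I_m -> T} | (j \in mono e c) && (c (e (inr j)) == b)]|
    = n b ^ a.+1 * #|T| ^ m.-1.
  transitivity #|(family (fun l : 'I_a + 'I_m =>
      [pred x | (if l is inr j' then j' == j else true) ==> (c x == b)])
        : pred {ffun 'I_a + 'I_m -> T})|.
    rewrite cardsE; apply: eq_card => e; rewrite unfold_in /= !inE.
    apply/andP/forallP => [[/forallP jm /eqP <-] [i|j'] /=|H].
    - by rewrite ?inE /=.
    - by rewrite ?inE /=; apply/implyP => /eqP ->.
    have := H (inr j); rewrite ?inE /= eqxx /= => cj; split=> //.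
    by apply/forallP => i; have := H (inl i); rewrite ?inE /= => /eqP ->; rewrite eq_sym.
  rewrite card_family_prod big_sumType /= (bigD1 j) //= mulnA expnSr.
  congr (_ * _ * _).
  - by rewrite prod_nat_const card_ord; congr (_ ^ _).
  - by apply: eq_card => x; rewrite unfold_in /= eqxx.
  rewrite (eq_bigr (fun=> #|T|)) => [|l /negbTE lj]; last first.
    by apply: eq_card => x; rewrite unfold_in /= lj.
  rewrite prod_nat_const; congr (_ ^ _); rewrite -[m in RHS]card_ord [in RHS](cardD1 j) inE /=.
  by apply: eq_card => l; rewrite ?inE /= ?andbT.
have -> : #|[set e : {ffun 'I_a + 'I_m -> T} | j \in mono e c]| =
    (n true ^ a.+1 + n false ^ a.+1) * #|T| ^ m.-1.
  rewrite mulnDl -!cnt -sum1dep_card.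
  rewrite (partition_big (fun e : {ffun 'I_a + 'I_m -> T} => c (e (inr j))) predT) //=.
  by rewrite big_bool !sum1dep_card.
have nT : n true + n false = #|T|.
  rewrite -(cardC [pred x | c x == true]); congr (_ + _).
  by apply: eq_card => x; rewrite !inE; case: (c x).
have -> : a + m = a.+1 + m.-1 by case: m j {cnt} => [[]//|m' _] /=; rewrite addnS.
by rewrite expnD -nT mulnA leq_mul2r expn_mean orbT.
Qed.

Lemma sum_mono (a m : nat) (T : finType) (c : T -> bool) :
  m * #|T| ^ (a + m) <= 2 ^ a * \sum_(e : {ffun 'I_a + 'I_m -> T}) #|mono e c|.
Proof.
have -> : \sum_(e : {ffun 'I_a + 'I_m -> T}) #|mono e c| =
    \sum_(j < m) #|[set e : {ffun 'I_a + 'I_m -> T} | j \in mono e c]|.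
  rewrite (eq_bigr (fun e => \sum_(j | j \in mono e c) 1)) => [|e _]; last by rewrite sum1_card.
  rewrite (exchange_big_dep predT) //=; apply: eq_bigr => j _.
  by rewrite -sum1dep_card.
rewrite big_distrr /= -[m in m * _]card_ord -sum_nat_const.
by apply: leq_sum => j _; apply: card_mono_coord.
Qed.

(** The ball bound depends on [D] but not on [N], so [D] is fixed first against saturation and [N]
    afterwards against closeness. *)
Lemma exists_few_not_spread (I : finType) (d q L : nat) :
  0 < #|I| -> 0 < d -> 0 < q ->
  exists D N : nat, 0 < N /\ forall es : seq {ffun I -> 'I_N},
    packed D L es -> size es <= d * N ->
    q * #|[set e : {ffun I -> 'I_N} | ~~ spread D L es e]| <= 2 * N ^ #|I|.
Proof.
(* With this [D] at most [N / (#|I| * q)] vertices are saturated, and [N] is [q] times the closeness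
   term; each kind of bad tuple has proportion at most [1 / q]. *)
move=> I0 d0 q0; pose D := #|I| ^ 2 * d * q; pose b := (1 + #|I| * D) ^ L.
exists D, (q * (#|I| ^ 2 * b)); set N := q * _.
have N0 : 0 < N by rewrite !muln_gt0 q0 !expn_gt0 I0.
split=> // es pk szes.
have := card_not_spread pk; rewrite card_ord -/b.
set S := #|[set x | _]|; set X := #|[set e | _]| => H.
have HS : q * (#|I| * S) <= N.
  have : S * D <= #|I| * (d * N).
    by apply: leq_trans (card_saturated _ _) _; rewrite leq_mul2l szes orbT.
  have rd0 : 0 < #|I| * d by rewrite muln_gt0 I0.
  move=> le; rewrite -(leq_pmul2l rd0); apply: leq_trans (leq_trans _ le) _.
    by apply: eq_leq; rewrite /D; ring.
  by apply: eq_leq; ring.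
rewrite -(leq_pmul2r N0) -mulnA; apply: leq_trans (leq_mul (leqnn q) H) _.
apply: (@leq_trans (2 * N * N ^ #|I|)); last by rewrite mulnAC.
by rewrite mulnA leq_mul2r mulnDr mul2n -addnn leq_add ?orbT.
Qed.

(** * Greedy choice by a potential function *)

Local Open Scope ring_scope.

Definition mono_ratio {R : realType} {a m : nat} {T : finType}
    (e : {ffun 'I_a + 'I_m -> T}) (c : T -> bool) : R := #|mono e c|%:R / m%:R.

Definition potential {R : realType} {a m : nat} {T : finType} (d : R)
    (es : seq {ffun 'I_a + 'I_m -> T}) : R :=
  \sum_(c : {ffun T -> bool}) expR (- (d * \sum_(e <- es) mono_ratio e c)).

(** Combines [expR x >= 1 + x] with [(1 + x) * (1 - x + x ^+ 2) = 1 + x ^+ 3 >= 1]. *)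
Lemma expRN_le (R : realType) (x : R) : 0 <= x -> expR (- x) <= 1 - x + x ^+ 2.
Proof.
move=> x0; have x1 : 0 < 1 + x by lra.
rewrite expRN; apply: (@le_trans _ _ (1 + x)^-1).
  by rewrite lef_pV2 ?posrE ?expR_gt0 ?expR_ge1Dx.
rewrite -[_^-1]mul1r ler_pdivrMr //; nra.
Qed.

Lemma mono_ratio_bounds (R : realType) (a m : nat) (T : finType)
    (e : {ffun 'I_a + 'I_m -> T}) (c : T -> bool) :
  0 <= (mono_ratio e c : R) <= 1.
Proof.
rewrite /mono_ratio divr_ge0 ?ler0n //=.
(* For [m = 0] the ratio is 0, since inversion sends 0 to 0. *)
case: m e => [|m] e; first by rewrite invr0 mulr0.
by rewrite ler_pdivrMr ?ltr0n // mul1r ler_nat -[m.+1 in X in (_ <= X)%N]card_ord max_card.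
Qed.

Lemma sum_mono_ratio (R : realType) (a m : nat) (T : finType) (c : T -> bool) :
  (0 < m)%N ->
  (2 ^+ a)^-1 * (#|T| ^ (a + m))%:R <=
    \sum_(e : {ffun 'I_a + 'I_m -> T}) mono_ratio e c :> R.
Proof.
move=> m0; have := sum_mono a m c.
rewrite -(ler_nat R) !natrM (natrX _ 2) natr_sum => H.
rewrite -mulr_suml ler_pdivlMr ?ltr0n // -mulrA ler_pdivrMl ?exprn_gt0 //.
by rewrite [_ * m%:R]mulrC.
Qed.

(** Excluding a proportion [d] of the tuples lowers the bound 2^-a on the mean ratio by at most [d].
    Multiplied by [d], this loss joins the quadratic error of [expRN_le] to give [2 * d ^+ 2]. *)
Lemma sum_spread_expR (R : realType) (a m : nat) (T : finType) (c : T -> bool) (d : R)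
    (S : pred {ffun 'I_a + 'I_m -> T}) :
  (0 < m)%N -> 0 <= d -> d <= (2 ^+ a)^-1 ->
  #|[set e | ~~ S e]|%:R <= d * (#|T| ^ (a + m))%:R ->
  \sum_(e | S e) expR (- (d * mono_ratio e c)) <=
    #|[set e | S e]|%:R * expR (2 * d ^+ 2 - d * (2 ^+ a)^-1).
Proof.
move=> m0 d0; set p := (2 ^+ a)^-1 => dp few.
set M := (#|T| ^ (a + m))%:R in few.
have cardS : #|[set e | S e]|%:R = \sum_(e | S e) (1 : R) by rewrite sumr_const cardsE.
have cardS' : #|[set e | ~~ S e]|%:R = \sum_(e | ~~ S e) (1 : R).
  by rewrite sumr_const cardsE.
have cardM : (\sum_(e | S e) 1) + (\sum_(e | ~~ S e) 1) = M :> R.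
  transitivity (\sum_(e : {ffun 'I_a + 'I_m -> T}) (1 : R)); first by rewrite [RHS](bigID S).
  by rewrite sumr_const card_ffun card_sum !card_ord.
have lowX : (p - d) * #|[set e | S e]|%:R <= \sum_(e | S e) (mono_ratio e c : R).
  have := sum_mono_ratio R a c m0; rewrite (bigID S) /= -/p -/M => H.
  have le1 : \sum_(e | ~~ S e) (mono_ratio e c : R) <= \sum_(e | ~~ S e) 1.
    by apply: ler_sum => e _; case/andP: (mono_ratio_bounds R e c).
  have s0 : 0 <= \sum_(e | ~~ S e) (1 : R) by apply: sumr_ge0.
  rewrite cardS' in few; rewrite cardS.
  move: cardM few H le1 s0; move: (\sum_(e | S e) 1) (\sum_(e | ~~ S e) 1) M => x y M' <-.
  nra.
apply: (@le_trans _ _ (\sum_(e | S e) (1 + d ^+ 2 - d * mono_ratio e c))).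
  apply: ler_sum => e _; have /andP[X0 X1] := mono_ratio_bounds R e c.
  have dX : (d * mono_ratio e c) ^+ 2 <= d ^+ 2.
    by rewrite exprMn ler_piMr ?sqr_ge0 // exprn_ile1.
  apply: le_trans (expRN_le (mulr_ge0 d0 X0)) _; lra.
have -> : \sum_(e | S e) (1 + d ^+ 2 - d * mono_ratio e c) =
    #|[set e | S e]|%:R * (1 + d ^+ 2) - d * \sum_(e | S e) mono_ratio e c.
  by rewrite sumrB -mulr_sumr sumr_const cardsE [in RHS]mulr_natl.
apply: (@le_trans _ _ (#|[set e | S e]|%:R * (1 + (2 * d ^+ 2 - d * p)))).
  have := ler_wpM2l d0 lowX; rewrite mulrA.
  set x := _%:R; set y := \sum_(e | S e) _.
  nra.
by rewrite ler_wpM2l ?ler0n ?expR_ge1Dx.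
Qed.

(** Averaging: a new tuple multiplies each colouring's term by an exponential whose mean over [S] is
    at most the stated factor, so some tuple of [S] does no worse. *)
Lemma greedy_step (R : realType) (a m : nat) (T : finType) (d : R)
    (es : seq {ffun 'I_a + 'I_m -> T}) (S : pred {ffun 'I_a + 'I_m -> T}) :
  (0 < m)%N -> (0 < #|T|)%N -> 0 <= d -> d < 1 -> d <= (2 ^+ a)^-1 ->
  #|[set e | ~~ S e]|%:R <= d * (#|T| ^ (a + m))%:R ->
  exists2 e, S e &
    potential d (e :: es) <= potential d es * expR (2 * d ^+ 2 - d * (2 ^+ a)^-1).
Proof.
move=> m0 T0 d0 d1 dp few; set g := expR _.
(* Some tuple is allowed because the excluded proportion is at most [d < 1]. *)
have S0 : (0 < #|[set e | S e]|)%N.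
  rewrite lt0n; apply/eqP => /cards0_eq S0.
  have : #|[set e | ~~ S e]|%:R = (#|T| ^ (a + m))%:R :> R.
    have -> : [set e | ~~ S e] = ~: [set e | S e] by apply/setP => e; rewrite !inE.
    by rewrite S0 setC0 cardsT card_ffun card_sum !card_ord.
  move=> eqM; rewrite eqM in few.
  have : 0 < (#|T| ^ (a + m))%:R :> R by rewrite ltr0n expn_gt0 T0.
  by move: few; move: (_ %:R) => M; nra.
have sumS : \sum_(e | S e) potential d (e :: es) <= \sum_(e | S e) potential d es * g.
  rewrite sumr_const -[#|S|]cardsE /potential exchange_big /= -mulr_natl mulrCA mulr_suml.
  apply: ler_sum => c _.
  under eq_bigr => e _ do rewrite big_cons mulrDr opprD expRD mulrC.
  by rewrite -mulr_sumr ler_wpM2l ?expR_ge0 ?sum_spread_expR.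
case: (pickP [pred e | S e && (potential d (e :: es) <= potential d es * g)])
  => [e /andP[Se le]|none].
  by exists e.
have [e0] := card_gt0P S0; rewrite inE => Se0.
suff : \sum_(e | S e) potential d es * g < \sum_(e | S e) potential d (e :: es).
  by rewrite ltNge sumS.
rewrite (bigD1 e0) // [ltRHS](bigD1 e0) //=.
have lt e : S e -> potential d es * g < potential d (e :: es).
  by move=> Se; have := none e; rewrite /= Se /= => /negbT; rewrite -ltNge.
by apply: ltr_leD; [exact: lt|apply: ler_sum => e /andP[Se _]; apply/ltW/lt].
Qed.

Lemma greedy (R : realType) (a m : nat) (T : finType) (D L t : nat) (d : R) :
  (0 < m)%N -> (0 < #|T|)%N -> 0 <= d -> d < 1 -> d <= (2 ^+ a)^-1 ->
  (forall es : seq {ffun 'I_a + 'I_m -> T}, packed D L es -> (size es <= t)%N ->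
     #|[set e | ~~ spread D L es e]|%:R <= d * (#|T| ^ (a + m))%:R) ->
  exists es : seq {ffun 'I_a + 'I_m -> T}, [/\ packed D L es, size es = t &
    potential d es <= expR (#|T|%:R + t%:R * (2 * d ^+ 2 - d * (2 ^+ a)^-1))].
Proof.
move=> m0 T0 d0 d1 dp; elim: t => [|t IH] few.
  (* The empty list has potential 2^|T|, the number of colourings, and [2 <= expR 1]. *)
  exists [::]; split=> //; rewrite mul0r addr0 /potential.
  under eq_bigr do rewrite big_nil mulr0 oppr0 expR0.
  rewrite sumr_const card_ffun card_bool natrX -[#|T|%:R]mulr1 expRM_natl.
  by apply: lerXn2r; rewrite ?nnegrE ?expR_ge0 //; have := expR_ge1Dx (1 : R); lra.
have [es [pk sz pot]] := IH (fun es pk sz => few es pk (leqW sz)).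
have [e sp le] := greedy_step es m0 T0 d0 d1 dp (few es pk (leq_trans (eq_leq sz) (leqnSn t))).
exists (e :: es); split; rewrite /= ?sp ?sz //.
apply: le_trans le _; rewrite -[t.+1%:R]natr1 [(t%:R + 1) * _]mulrDl mul1r addrA [leRHS]expRD.
by rewrite ler_wpM2r ?expR_ge0.
Qed.

Lemma potential_ge (R : realType) (a m : nat) (T : finType) (d : R)
    (es : seq {ffun 'I_a + 'I_m -> T}) (c : T -> bool) :
  expR (- (d * \sum_(e <- es) mono_ratio e c)) <= potential d es.
Proof.
(* [potential] ranges over finite functions, so [c] enters through its tabulation. *)
rewrite /potential (bigD1 (finfun c)) //=.
rewrite (eq_bigr (fun e => mono_ratio e [ffun x => c x])) => [|e _]; last first.
  rewrite /mono_ratio; congr (_%:R / _); apply: eq_card => j; rewrite !inE.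
  by apply: eq_forallb => i; rewrite !ffunE.
by rewrite lerDl sumr_ge0 // => c' _; apply: expR_ge0.
Qed.

(** * Choice of parameters and the final bound *)

Lemma exists_pos_nat_ge (R : realType) (x : R) : exists2 n : nat, (0 < n)%N & x <= n%:R.
Proof.
exists (Num.bound `|x|).+1 => //; rewrite -natr1 ler_wpDr ?ler01 //.
exact/ltW/(le_lt_trans (ler_norm x))/archi_boundP.
Qed.

Lemma exists_quasirandom_packing (R : realType) (a m L : nat) (d : R) :
  (0 < m)%N -> 0 < d -> d < 1 -> d <= (2 ^+ a)^-1 ->
  exists (T : finType) (D : nat) (es : seq {ffun 'I_a + 'I_m -> T}),
    [/\ packed D L es, (0 < size es)%N & forall c : T -> bool,
      (size es)%:R * ((2 ^+ a)^-1 - 3 * d) <= \sum_(e <- es) mono_ratio e c :> R].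
Proof.
move=> m0 d0 d1 dp.
(* [q] makes the excluded proportion [2 / q] at most [d]; [w] makes the initial exponent [N] cost at
   most [d ^+ 2] for each of the [w * N] tuples. *)
have [q q0 qP] := exists_pos_nat_ge (2 / d); have [w w0 wP] := exists_pos_nat_ge (d ^+ 2)^-1.
have I0 : (0 < #|{: 'I_a + 'I_m}|)%N by rewrite card_sum !card_ord addn_gt0 m0 orbT.
have [D [N [N0 few]]] := exists_few_not_spread L I0 w0 q0.
have T0 : (0 < #|'I_N|)%N by rewrite card_ord.
have few' (es : seq {ffun 'I_a + 'I_m -> 'I_N}) : packed D L es -> (size es <= w * N)%N ->
    #|[set e | ~~ spread D L es e]|%:R <= d * (#|'I_N| ^ (a + m))%:R.
  move=> pk sz; have := few es pk sz; rewrite card_ord card_sum !card_ord.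
  rewrite -(ler_nat R) !natrM; have := ler0n R #|[set e | ~~ spread D L es e]|.
  move: (#|_|%:R) ((N ^ (a + m))%:R : R).
  move=> x M x0 H.
  have : 2 <= q%:R * d by rewrite -ler_pdivrMr.
  nra.
have [es [pk sz pot]] := greedy m0 T0 (ltW d0) d1 dp few'.
exists 'I_N, D, es; split; rewrite // ?sz ?muln_gt0 ?w0 ?N0 // => c.
have := le_trans (potential_ge d es c) pot; rewrite ler_expR card_ord natrM.
have : 1 <= w%:R * d ^+ 2 by rewrite -ler_pdivrMr ?exprn_gt0 // mul1r.
have : 0 < N%:R :> R by rewrite ltr0n.
move: (N%:R) (w%:R) (\sum_(e <- es) _) (2 ^+ a)^-1 => n w' X p n0 w1 H.
(* The exponents give [d * X >= t * (d * p - 2 * d ^+ 2) - n] with [t = w' * n] and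
   [n <= t * d ^+ 2], hence the error [3 * d] after division by [d]. *)
rewrite -(ler_pM2l d0); nra.
Qed.

Lemma packed_nedges_bound (R : realType) (a m : nat) (T : finType) (D L : nat)
    (es : seq {ffun 'I_a + 'I_m -> T}) (F : rel T) (c : T -> bool) :
  (0 < m)%N -> packed D L es -> subgraph F (union_graph es) -> cycle_free F 4 ->
  (forall x y, F x y -> c x != c y) ->
  (nedges F)%:R + m%:R * \sum_(e <- es) mono_ratio e c
    <= (size es)%:R * (m%:R + a%:R ^+ 2) :> R.
Proof.
move=> m0 pk subF noC4 propc.
have -> : m%:R * \sum_(e <- es) mono_ratio e c = (\sum_(e <- es) #|mono e c|)%:R :> R.
  rewrite mulr_sumr natr_sum; apply: eq_bigr => e _.
  by rewrite /mono_ratio mulrC mulfVK // pnatr_eq0 -lt0n.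
rewrite -natrX -!natrD -natrM ler_nat.
apply: leq_trans (leq_add (nedges_le_bipairs subF) (leqnn _)) _.
rewrite -big_split /=; case: subF => symF _.
elim: es pk => [|e es IH] /=; first by rewrite big_nil.
case/andP=> sp pk; rewrite big_cons mulSn leq_add ?IH //.
exact: bipairs_mono_bound (spread_inj sp) symF noC4 propc.
Qed.

Theorem theorem4 (R : realType) (eps : R) (k : nat) :
  0 < eps -> (2 <= k)%N ->
  exists (T : finType) (E : rel T),
    [/\ simple_graph E, (0 < nedges E)%N, cycle_free E (2 * k) &
      forall F : rel T, subgraph F E -> bipartite F -> cycle_free F 4 ->
        (nedges F)%:R <=
          (1 - 1 / 2 ^+ (k.-1)) * (1 / (k.-1)%:R) * (nedges E)%:R * (1 + eps)].
Proof.
move=> eps0; case: k => [//|[//|a']] _; set a := a'.+1; rewrite [a.+1.-1]/=.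
pose p : R := (2 ^+ a)^-1; have p0 : 0 < p by rewrite invr_gt0 exprn_gt0.
have p2 : p <= 1 / 2.
  by rewrite /p exprS invfM mul1r ler_piMr ?invr_ge0 // invf_le1 ?exprn_gt0 // exprn_ege1 // ler1n.
(* As [p <= 1 / 2], the slack [(1 - p) * eps * m] is at least [eps * m / 2]; the loss [3 * d * m]
   takes at most half of this, and [m] is chosen so that [a ^ 2] takes at most the other half. *)
pose d := Num.min p (eps / 12).
have d0 : 0 < d by rewrite lt_min p0 divr_gt0.
have dp : d <= p by rewrite ge_min lexx.
have deps : d <= eps / 12 by rewrite ge_min lexx orbT.
have d1 : d < 1 by lra.
have [m m0 mP] := exists_pos_nat_ge (4 * a%:R ^+ 2 / eps).
rewrite ler_pdivrMr // in mP.
have [T [D [es [pk sz quasi]]]] :=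
  exists_quasirandom_packing (2 * a.+1) m0 d0 d1 dp.
exists T, (union_graph es).
have cardE := nedges_packed (isT : 0 < 2 * a.+1)%N pk.
split; first exact: union_graph_simple pk.
- by apply: leq_trans cardE; rewrite !muln_gt0 sz.
- exact: packed_cycle_free pk.
move=> F subF [c propc] noC4.
have := packed_nedges_bound R m0 pk subF noC4 propc.
have := quasi c; rewrite -/p.
have := cardE; rewrite -(ler_nat R) !natrM.
have a0 : 0 < a%:R :> R by rewrite ltr0n.
have s0 : 0 < (size es)%:R :> R by rewrite ltr0n.
have m0' : 0 < m%:R :> R by rewrite ltr0n.
rewrite !div1r -/p.
move: (\sum_(e <- es) _) ((size es)%:R) ((nedges F)%:R) ((nedges _)%:R) s0
  => X s nF nE s0 leE leX leF.
(* The factor [1 / (k - 1)] arises here: each tuple contributes [a * m] edges, with [a = k - 1]. *)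
have sE : s * m%:R <= a%:R^-1 * nE by rewrite ler_pdivlMl // mulrCA.
apply: (@le_trans _ _ ((1 - p) * (s * m%:R) * (1 + eps))); last first.
  by rewrite ler_wpM2r ?addr_ge0 ?(ltW eps0) // -[_ * _ * nE]mulrA ler_wpM2l //; lra.
apply: (@le_trans _ _ (s * (m%:R + a%:R ^+ 2 - m%:R * (p - 3 * d)))).
  nra.
have -> : (1 - p) * (s * m%:R) * (1 + eps) = s * ((1 - p) * m%:R * (1 + eps)) by ring.
rewrite ler_pM2l //.
have dm : 0 <= m%:R * (eps / 12 - d) by rewrite mulr_ge0 ?subr_ge0.
have pm : 0 <= (1 / 2 - p) * (eps * m%:R) by rewrite mulr_ge0 ?subr_ge0 // mulr_ge0 // ltW.
lra.
Qed.
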